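(* The matching policies FCFM (''First Come, First Matched'') and LCFM (''Last Come, First Matched'') are sub-additive: for $\phi\in\{\mathrm{FCFM},\mathrm{LCFM}\}$ and all words $z',z''\in\mathcal V^*$, $$|W_\phi(z'z'')|\le|W_\phi(z')|+|W_\phi(z'')|.$$
   Context: Let $G=(\mathcal V,\mathcal E)$ be a finite connected simple graph; $\mathcal E(v)$ is the set of neighbors of $v$. $\mathcal V^*$ is the set of finite words over $\mathcal V$, $|w|$ is the length of $w$, $\emptyset$ is the empty word, and $|w|_i$ is the number of occurrences of $i$ in $w$. Let $\mathbb W=\{w\in\mathcal V^*:|w|_i|w|_j=0\text{ for all }(i,j)\in\mathcal E\}$ be the set of queue details (classes of stored items in order of arrival). For $w=w_1\cdots w_q\in\mathbb W$ and an arriving item of class $v\in\mathcal V$, the updated queue detail $w\odot_\phi v$ is $wv$ if no letter of $w$ belongs to $\mathcal E(v)$; otherwise it is $w$ with its letter at position $\Phi$ deleted (this item is the match of the arriving item), where, for FCFM, $\Phi=\min\{k:w_k\in\mathcal E(v)\}$ (oldest compatible item) and, for LCFM, $\Phi=\max\{k:w_k\in\mathcal E(v)\}$ (most recent compatible item). (These policies do not depend on any list of preferences.) For $z=v_1\cdots v_n\in\mathcal V^*$, $W_\phi(z)=(\cdots((\emptyset\odot_\phi v_1)\odot_\phi v_2)\cdots)\odot_\phi v_n$. *)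

(* Defs.v *)
From mathcomp Require Import all_boot.

Set Implicit Arguments.
Unset Strict Implicit.
Unset Printing Implicit Defensive.

(* A simple graph on the finite type V is given by its adjacency relation
   e : rel V (symmetric and irreflexive); words over V are sequences, the
   oldest letter coming first. *)

Inductive policy := FCFM | LCFM.

Section Matching.

Variables (V : finType) (e : rel V).

Definition queue_detail (w : seq V) : bool :=
  [forall i, forall j, e i j ==> (count_mem i w * count_mem j w == 0)].

(* Positions are counted from 0.  The value of match_pos is meaningful only
   when some letter of w is a neighbour of v.  The default letter v of nth is
   never used, since k ranges over the positions of w. *)
Definition match_pos (phi : policy) (w : seq V) (v : V) : nat :=
  match phi with
  | FCFM => find (e v) w
  | LCFM => \max_(k < size w | e v (nth v w k)) k
  end.

Definition delete_at (k : nat) (w : seq V) : seq V := take k w ++ drop k.+1 w.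

(* The update is defined on all words; only its values on queue details
   matter, by queue_detail_queue below. *)
Definition arrival (phi : policy) (w : seq V) (v : V) : seq V :=
  if has (e v) w then delete_at (match_pos phi w v) w else rcons w v.

Definition queue (phi : policy) (z : seq V) : seq V :=
  foldl (arrival phi) [::] z.

Lemma queue_detailP (w : seq V) :
  reflect (forall i j, e i j -> i \in w -> j \in w -> False) (queue_detail w).
Proof.
apply: (iffP forallP) => [H i j eij iw jw | H i].
  have /forallP/(_ j)/implyP/(_ eij) := H i.
  by rewrite muln_eq0 !eqn0Ngt -!has_count !has_pred1 iw jw.
apply/forallP => j; apply/implyP => eij.
rewrite muln_eq0 !eqn0Ngt -!has_count !has_pred1 -negb_and.
by apply/negP => /andP[]; apply: H.
Qed.

Lemma queue_detail_queue (e_sym : symmetric e) (e_irr : irreflexive e)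
  (phi : policy) (z : seq V) : queue_detail (queue phi z).
Proof.
elim/last_ind: z => [|z v]; first by apply/queue_detailP.
rewrite /queue foldl_rcons -/(queue phi z) => /queue_detailP H.
apply/queue_detailP => i j eij; rewrite /arrival; case: hasP => [_ | nH].
  have sub x : x \in delete_at (match_pos phi (queue phi z) v) (queue phi z) ->
      x \in queue phi z.
    by rewrite mem_cat => /orP[/mem_take | /mem_drop].
  by move=> /sub iw /sub jw; apply: H eij iw jw.
rewrite !mem_rcons !inE => /predU1P[ei | iw] /predU1P[ej | jw].
- by rewrite ei ej e_irr in eij.
- by apply: nH; exists j => //; rewrite -ei.
- by apply: nH; exists i => //; rewrite -ej e_sym.
- exact: H eij iw jw.
Qed.

End Matching.

(* Main.v *)
Require Import Defs.
From mathcomp Require Import all_boot.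

(** Both policies are non-expansive for the insertion of a single letter, at an
    arbitrary place of the queue.  Call two words adjacent if they are equal or
    if one is obtained from the other by deleting one letter; the claim is that
    adjacency survives every arrival ([adjacent_arrival]).

    Let the queue [w] have one letter [a] more than the queue [x], and let [v]
    arrive.  The policy scans each queue from one end (the oldest for FCFM, the
    newest for LCFM) and takes the first neighbour of [v].  Unless this neighbour
    is [a] in [w], the two queues lose the same letter or both gain [v], and [a]
    is still the only difference.  If it is [a], then [w] becomes [x], while [x]
    itself loses one letter or gains the letter [v]: the queues are again adjacent,
    possibly with the roles of the longer and of the shorter exchanged.  The
    argument rests on the match being the first in a linear scan, so that the
    presence of [a] cannot change the ranking of the other letters
    ([delete_match_deletion]).

    Consequently the lengths reached from adjacent queues by the same arrivals
    differ by at most one.  Removing the letters of [queue e phi z'] one by one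
    leads in [size (queue e phi z')] steps to the empty queue, from which the
    arrivals of [z''] lead to [queue e phi z'']. *)

Set Implicit Arguments.
Unset Strict Implicit.
Unset Printing Implicit Defensive.

Section Deletion.

Variable T : finType.
Implicit Types (p : pred T) (x w : seq T).

Variant deletion : seq T -> seq T -> Prop :=
  Deletion w1 a w2 : deletion (w1 ++ a :: w2) (w1 ++ w2).

Variant adjacent w x : Prop :=
  | AdjacentRefl of w = x
  | AdjacentLonger of deletion w x
  | AdjacentShorter of deletion x w.

Lemma deletion_rev w x : deletion w x -> deletion (rev w) (rev x).
Proof. by case=> w1 a w2; rewrite !rev_cat rev_cons cat_rcons. Qed.

Lemma deletion_catr s w x : deletion w x -> deletion (w ++ s) (x ++ s).
Proof. by case=> w1 a w2; rewrite -!catA. Qed.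

Lemma deletion_rcons w v : deletion (rcons w v) w.
Proof. by rewrite -cats1 -{2}[w]cats0. Qed.

Lemma deletion_has p w x : deletion w x -> has p x -> has p w.
Proof. by case=> w1 a w2; rewrite !has_cat /= orbCA => ->; rewrite orbT. Qed.

Lemma deletion_delete_at k w : k < size w -> deletion w (delete_at k w).
Proof.
case: w => // a w ltk; rewrite -{1}(cat_take_drop k (a :: w)).
by rewrite (drop_nth a ltk).
Qed.

Lemma delete_at_catl k s w :
  k < size s -> delete_at k (s ++ w) = delete_at k s ++ w.
Proof.
move=> ltk; rewrite /delete_at take_cat ltk drop_cat -catA.
case: ltnP => // les; have/eqP-> : k.+1 - size s == 0 by rewrite subn_eq0.
by rewrite drop0 (drop_oversize les).
Qed.

Lemma delete_at_catr k s w :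
  delete_at (size s + k) (s ++ w) = s ++ delete_at k w.
Proof.
rewrite /delete_at take_cat drop_cat ltnNge leq_addr /= addKn.
by rewrite ltnNge -addnS leq_addr /= addKn catA.
Qed.

(** The scan from the old end: when the extra letter [a] is the first one
    satisfying [p], its removal yields [x]; otherwise both scans stop at the same
    letter, before or after [a]. *)
Lemma delete_find_deletion p w x : deletion w x -> has p w ->
  delete_at (find p w) w = x \/
  has p x /\ deletion (delete_at (find p w) w) (delete_at (find p x) x).
Proof.
case=> w1 a w2; rewrite !has_cat /= !find_cat /=.
have [p1 _ | _ /=] := boolP (has p w1).
  by right; split=> //; rewrite !delete_at_catl -?has_find.
have [_ _ | _ /= p2] := boolP (p a).
  by left; rewrite delete_at_catr /delete_at /= drop0.
right; split=> //; rewrite !delete_at_catr /delete_at /=.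
exact: Deletion.
Qed.

Lemma delete_at_rev k w : k < size w ->
  delete_at (size w - k.+1) w = rev (delete_at k (rev w)).
Proof.
move=> ltk; rewrite /delete_at rev_cat take_rev drop_rev !revK.
by rewrite subnSK.
Qed.

Lemma adjacent_size w x : adjacent w x -> size w <= (size x).+1.
Proof.
case=> [->|[w1 a w2]|[w1 a w2]]; rewrite ?size_cat /= ?addnS //.
by rewrite leqW // leqW.
Qed.

End Deletion.

Section Arrival.

Variables (V : finType) (e : rel V).
Implicit Types (phi : policy) (v : V) (w x z : seq V).

(** The largest position of a neighbour is found by FCFM's scan of the reversed
    queue, which lets both policies share [delete_find_deletion]. *)
Lemma match_pos_LCFM w v : has (e v) w ->
  match_pos e LCFM w v = size w - (find (e v) (rev w)).+1.
Proof.
rewrite -has_rev => ev; have ltf := ev; rewrite has_find size_rev in ltf.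
have ltk : size w - (find (e v) (rev w)).+1 < size w.
  by rewrite ltn_subrL /= (leq_ltn_trans _ ltf).
apply/eqP; rewrite eqn_leq; apply/andP; split; last first.
  apply: (leq_bigmax_cond (Ordinal ltk)).
  by rewrite /= -nth_rev // nth_find.
(* A neighbour at a newer position would precede the first hit of the scan of
   the reversed queue. *)
apply/bigmax_leqP => k evk.
have ltk' := ltn_ord k; rewrite leqNgt; apply/negP => ltfk.
have lt : size w - k.+1 < find (e v) (rev w).
  by rewrite ltn_subLR // addSnnS addnC -ltn_subLR.
have := before_find v lt; rewrite nth_rev; last first.
  by rewrite ltn_subrL (leq_ltn_trans _ ltk').
by rewrite subnSK // subKn ?evk // ltnW.
Qed.

Lemma delete_match_LCFM w v : has (e v) w ->
  delete_at (match_pos e LCFM w v) w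
  = rev (delete_at (find (e v) (rev w)) (rev w)).
Proof.
move=> ev; rewrite match_pos_LCFM // delete_at_rev //.
by rewrite -size_rev -has_find has_rev.
Qed.

Lemma deletion_match phi w v :
  has (e v) w -> deletion w (delete_at (match_pos e phi w v) w).
Proof.
case: phi => ev.
  by apply: deletion_delete_at; rewrite -has_find.
rewrite delete_match_LCFM // -{1}[w]revK.
by apply/deletion_rev/deletion_delete_at; rewrite -has_find has_rev.
Qed.

(** Unless the extra letter is itself the match, the first hit of the scan is a
    common letter.  A policy that can change its choice among the common letters
    because of the extra one would fail this. *)
Lemma delete_match_deletion phi w x v : deletion w x -> has (e v) w ->
  delete_at (match_pos e phi w v) w = x \/
  has (e v) x /\ deletion (delete_at (match_pos e phi w v) w)
                          (delete_at (match_pos e phi x v) x).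
Proof.
case: phi => wx ew; first exact: delete_find_deletion.
have ewr : has (e v) (rev w) by rewrite has_rev.
rewrite delete_match_LCFM //.
case: (delete_find_deletion (deletion_rev wx) ewr) => [->|[exr dr]].
  by left; rewrite revK.
rewrite has_rev in exr; right; split=> //.
by rewrite delete_match_LCFM //; apply: deletion_rev.
Qed.

(** The extra letter survives in the longer queue, or it is the match and then
    the order of the lengths may be reversed; this is why [adjacent] is symmetric. *)
Lemma deletion_arrival phi w x v :
  deletion w x -> adjacent (arrival e phi w v) (arrival e phi x v).
Proof.
move=> wx; rewrite /arrival; have [ew | new] := boolP (has (e v) w); last first.
  rewrite (negbTE (contra (deletion_has wx) new)).
  by apply: AdjacentLonger; rewrite -!cats1; apply: deletion_catr.
case: (delete_match_deletion phi wx ew) => [->|[ex dx]]; last first.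
  by rewrite ex; apply: AdjacentLonger.
(* The extra letter was the match, so [w] has become [x]; the other queue
   is what [x] becomes when [v] arrives. *)
have [ex | _] := boolP (has (e v) x).
  exact/AdjacentLonger/deletion_match.
exact/AdjacentShorter/deletion_rcons.
Qed.

Lemma adjacent_arrival phi w x v :
  adjacent w x -> adjacent (arrival e phi w v) (arrival e phi x v).
Proof.
case=> [->|wx|xw]; [exact: AdjacentRefl | exact: deletion_arrival |].
case: (deletion_arrival phi v xw) => [->|d|d];
  [exact: AdjacentRefl | exact: AdjacentShorter | exact: AdjacentLonger].
Qed.

Lemma adjacent_foldl_arrival phi z w x : adjacent w x ->
  adjacent (foldl (arrival e phi) w z) (foldl (arrival e phi) x z).
Proof. by elim: z w x => //= v z IHz w x wx; apply/IHz/adjacent_arrival. Qed.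

(** The letters of [w] are removed from the oldest one on, each at the cost of at
    most one unit of length; the empty queue remains. *)
Lemma size_foldl_arrival phi w z :
  size (foldl (arrival e phi) w z) <= size w + size (queue e phi z).
Proof.
elim: w => // a w IHw; rewrite /= addSn.
apply: leq_trans (IHw : _ < _.+1).
by apply/adjacent_size/adjacent_foldl_arrival/AdjacentLonger/(Deletion [::]).
Qed.

End Arrival.

Theorem proposition4 (V : finType) (e : rel V)
  (e_sym : symmetric e) (e_irr : irreflexive e)
  (e_conn : forall x y : V, connect e x y)
  (phi : policy) (z' z'' : seq V) :
  size (queue e phi (z' ++ z'')) <= size (queue e phi z') + size (queue e phi z'').
Proof. by rewrite /queue foldl_cat; apply: size_foldl_arrival. Qed.
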